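(* For each $k<\omega$, the bimodal logics $\mathrm{KB}^{\neq}+\mathrm{Con}$ and $\mathrm{KB}^{\neq}+\{\chi_k,\mathrm{Con}\}$ have the exponential finite model property and are decidable.
   Context: Bimodal formulas use modalities $\lozenge$ and $\langle\neq\rangle$ interpreted in Kripke frames $(X,R,D)$ by $R$ and $D$ respectively; $\exists\varphi:=\langle\neq\rangle\varphi\vee\varphi$, $\forall\varphi:=[\neq]\varphi\wedge\varphi$. Normal logics and $L+\Phi$ (smallest normal logic containing $L\cup\Phi$) are as usual. $\mathrm{KB}$ is the smallest normal unimodal logic containing $p\to\Box\lozenge p$; $\mathrm{KB}^{\neq}$ is the smallest normal bimodal logic containing $\mathrm{KB}$ and $p\to[\neq]\langle\neq\rangle p$, $\langle\neq\rangle\langle\neq\rangle p\to\exists p$, $\lozenge p\to\exists p$. $\chi_k$ is $\forall \bigvee_{i<k}(p_i\wedge\bigwedge_{i\neq j<k}\neg p_j)\to \exists\bigvee_{i<k}(p_i\wedge\lozenge p_i)$ and $\mathrm{Con}$ is $\exists p\wedge\exists\neg p\to\exists(p\wedge\lozenge\neg p)$. A logic $L$ has the exponential finite model property if every $\varphi\notin L$ is falsified in a frame validating $L$ with at most $2^n$ points, $n$ the number of subformulas of $\varphi$. *)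

(* Defs.v *)
From HB Require Import structures.
From mathcomp Require Import all_boot.
From mathcomp Require Import boolp classical_sets.

Set Implicit Arguments.
Unset Strict Implicit.
Unset Printing Implicit Defensive.

Local Open Scope classical_set_scope.

(* Modal formulas over an alphabet A of diamonds. *)
Inductive form (A : Type) : Type :=
| Var of nat
| Bot
| Imp of form A & form A
| Dia of A & form A.

Arguments Var {A} _.
Arguments Bot {A}.

Section FormEqType.
Variable A : eqType.

Fixpoint form_eqb (p q : form A) : bool :=
  match p, q with
  | Var i, Var j => i == j
  | Bot, Bot => true
  | Imp p1 p2, Imp q1 q2 => form_eqb p1 q1 && form_eqb p2 q2
  | Dia a p1, Dia b q1 => (a == b) && form_eqb p1 q1
  | _, _ => false
  end.

Lemma form_eqbP : Equality.axiom form_eqb.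
Proof.
elim=> [i||p1 IH1 p2 IH2|a p1 IH1] [j||q1 q2|b q1] /=; try by constructor.
- by apply: (iffP eqP) => [->|[]].
- apply: (iffP andP) => [[/IH1-> /IH2->]//|[<- <-]].
  by split; [apply/IH1|apply/IH2].
- apply: (iffP andP) => [[/eqP-> /IH1->]//|[<- <-]].
  by split; [apply/eqP|apply/IH1].
Qed.

HB.instance Definition _ := hasDecEq.Build (form A) form_eqbP.

End FormEqType.

Section Connectives.
Variable A : Type.
Implicit Types p q : form A.

Definition Neg p := Imp p Bot.
Definition Top : form A := Neg Bot.
Definition Or p q := Imp (Neg p) q.
Definition And p q := Neg (Imp p (Neg q)).
Definition Box (a : A) p := Neg (Dia a (Neg p)).

End Connectives.

Arguments Top {A}.

Section Logics.
Variable A : Type.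
Implicit Types (p q : form A) (L : set (form A)).

Fixpoint substf (s : nat -> form A) p : form A :=
  match p with
  | Var i => s i
  | Bot => Bot
  | Imp p1 p2 => Imp (substf s p1) (substf s p2)
  | Dia a p1 => Dia a (substf s p1)
  end.

(* Variables and formulas [Dia a p] are treated as propositional atoms, so
   the tautologies are the substitution instances of classical ones. *)
Fixpoint bool_eval (v : form A -> bool) p : bool :=
  match p with
  | Bot => false
  | Imp p1 p2 => bool_eval v p1 ==> bool_eval v p2
  | _ => v p
  end.

Definition tautology p := forall v, bool_eval v p.

(* Since diamonds are primitive, normality is expressed by the diamond forms
   of the axiom K and of the necessitation rule. *)
Record normal L : Prop := Normal {
  normal_taut : forall p, tautology p -> L p;
  normal_dia_bot : forall a, L (Neg (Dia a Bot));
  normal_dia_or : forall a,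
    L (Imp (Dia a (Or (Var 0) (Var 1)))
           (Or (Dia a (Var 0)) (Dia a (Var 1))));
  normal_mp : forall p q, L (Imp p q) -> L p -> L q;
  normal_subst : forall s p, L p -> L (substf s p);
  normal_mono : forall a p q, L (Imp p q) -> L (Imp (Dia a p) (Dia a q))
}.

Definition log_plus L (Phi : set (form A)) : set (form A) :=
  smallest normal (L `|` Phi).

End Logics.

Section Kripke.
Variable A : Type.

Record frame := Frame { world :> Type; acc : A -> world -> world -> Prop }.

Fixpoint sat (F : frame) (V : nat -> set F) (x : F) (p : form A) : Prop :=
  match p with
  | Var i => V i x
  | Bot => False
  | Imp p1 p2 => sat V x p1 -> sat V x p2
  | Dia a p1 => exists y, acc a x y /\ sat V y p1
  end.

Definition frame_valid (F : frame) (p : form A) :=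
  forall (V : nat -> set F) (x : F), sat V x p.

Definition falsified (F : frame) (p : form A) :=
  exists (V : nat -> set F) (x : F), ~ sat V x p.

Definition frame_of_logic (F : frame) (L : set (form A)) :=
  L `<=` frame_valid F.

End Kripke.

Section ExponentialFMP.
Variable A : eqType.

Fixpoint subforms (p : form A) : seq (form A) :=
  p :: match p with
       | Imp p1 p2 => subforms p1 ++ subforms p2
       | Dia _ p1 => subforms p1
       | _ => [::]
       end.

Definition num_subforms (p : form A) := size (undup (subforms p)).

Definition exponential_fmp (L : set (form A)) :=
  forall p : form A, ~ L p ->
    exists (X : finType) (R : A -> X -> X -> Prop),
      [/\ #|X| <= 2 ^ num_subforms p,
          frame_of_logic (Frame R) L
        & falsified (Frame R) p].

End ExponentialFMP.

(* The total recursive functions of Kleene; each clause characterizes the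
   defined function by its equations. *)
Inductive recursive : forall n, (n.-tuple nat -> nat) -> Prop :=
| rec_zero n : recursive (fun _ : n.-tuple nat => 0)
| rec_succ : recursive (fun v : 1.-tuple nat => (thead v).+1)
| rec_proj n (i : 'I_n) : recursive (fun v : n.-tuple nat => tnth v i)
| rec_comp m n (f : m.-tuple nat -> nat) (g : 'I_m -> n.-tuple nat -> nat)
    (h : n.-tuple nat -> nat) :
    recursive f -> (forall i, recursive (g i)) ->
    (forall v, h v = f [tuple g i v | i < m]) ->
    recursive h
| rec_primrec n (f : n.-tuple nat -> nat) (g : n.+2.-tuple nat -> nat)
    (h : n.+1.-tuple nat -> nat) :
    recursive f -> recursive g ->
    (forall v : n.-tuple nat, h [tuple of 0 :: v] = f v) ->
    (forall (v : n.-tuple nat) y,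
       h [tuple of y.+1 :: v] = g [tuple of y :: h [tuple of y :: v] :: v]) ->
    recursive h
| rec_min n (f : n.+1.-tuple nat -> nat) (h : n.-tuple nat -> nat) :
    recursive f ->
    (forall v : n.-tuple nat, f [tuple of h v :: v] = 0) ->
    (forall (v : n.-tuple nat) y, y < h v -> f [tuple of y :: v] <> 0) ->
    recursive h.

(* Bimodal formulas: [false] indexes the modality of R, [true] the
   difference modality of D. *)
Notation bform := (form bool).

Fixpoint goedel (p : bform) : nat :=
  match p with
  | Var i => CodeSeq.code [:: 0; i]
  | Bot => CodeSeq.code [:: 1]
  | Imp p1 p2 => CodeSeq.code [:: 2; goedel p1; goedel p2]
  | Dia a p1 => CodeSeq.code [:: 3; nat_of_bool a; goedel p1]
  end.

Definition decidable_logic (L : set bform) :=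
  exists f : 1.-tuple nat -> nat, recursive f /\
    forall p : bform, (L p -> f [tuple goedel p] = 1) /\
                      (~ L p -> f [tuple goedel p] = 0).

Definition DiaR (p : bform) : bform := Dia false p.
Definition DiaD (p : bform) : bform := Dia true p.
Definition BoxD (p : bform) : bform := Box true p.
Definition ExD (p : bform) : bform := Or (DiaD p) p.
Definition AllD (p : bform) : bform := And (BoxD p) p.

Definition KB : set (form unit) :=
  smallest (@normal unit) [set Imp (Var 0) (Box tt (Dia tt (Var 0)))].

Fixpoint of_unimodal (p : form unit) : bform :=
  match p with
  | Var i => Var i
  | Bot => Bot
  | Imp p1 p2 => Imp (of_unimodal p1) (of_unimodal p2)
  | Dia _ p1 => DiaR (of_unimodal p1)
  end.

Definition KBneq : set bform :=
  smallest (@normal bool)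
    (of_unimodal @` KB `|`
     [set Imp (Var 0) (BoxD (DiaD (Var 0)));
          Imp (DiaD (DiaD (Var 0))) (ExD (Var 0));
          Imp (DiaR (Var 0)) (ExD (Var 0))]).

Definition Chi (k : nat) : bform :=
  Imp (AllD (\big[@Or bool/Bot]_(i < k)
         And (Var i) (\big[@And bool/Top]_(j < k | j != i) Neg (Var j))))
      (ExD (\big[@Or bool/Bot]_(i < k) And (Var i) (DiaR (Var i)))).

Definition Con : bform :=
  Imp (And (ExD (Var 0)) (ExD (Neg (Var 0))))
      (ExD (And (Var 0) (DiaR (Neg (Var 0))))).

(* Main.v *)
(* A formula outside the logic fails at a point w of the canonical frame.
   Since D is canonically symmetric and pseudo-transitive and contains R up to
   equality, the worlds D-accessible from w, with w itself, form a subframe in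
   which any two distinct worlds are D-related.  Its minimal filtration through
   the subformulas has at most 2^n points.  Every set of points of the
   filtration is defined by a Boolean combination of subformulas, so the
   instances of Con and Chi_k for the defining formulas, which are true in the
   canonical model, force the filtration to be R-connected and without a proper
   k-colouring; hence it validates the logic.

   Decidability follows, because the existence of such a countermodel with at
   most 2^(goedel p) points is a bounded arithmetical statement once relations
   and truth values are coded by the bits of numbers: the truth conditions are
   imposed for all codes up to goedel p at once, with no recursion on formulas.
   The logic without Chi_k is the case k = 0, as Chi_0 is a tautology. *)
Require Import Defs.
From mathcomp Require Import all_boot.
From mathcomp Require Import boolp classical_sets.

Set Implicit Arguments.
Unset Strict Implicit.
Unset Printing Implicit Defensive.

Local Open Scope classical_set_scope.

(** * Kripke semantics *)

Ltac taut :=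
  let v := fresh "v" in
  move=> v /=;
  repeat match goal with
  | |- context [bool_eval v ?p] => case: (bool_eval v p)
  | |- context [v ?p] => case: (v p)
  end;
  by [].

Section Semantics.
Variables (A : Type) (F : frame A).
Implicit Types (V : nat -> set F) (x y : F) (p q : form A).

Lemma sat_imp V x p q : sat V x (Imp p q) = (sat V x p -> sat V x q).
Proof. by []. Qed.

Lemma sat_dia V x a p :
  sat V x (Dia a p) = exists y, acc a x y /\ sat V y p.
Proof. by []. Qed.

Lemma sat_or V x p q : sat V x (Or p q) <-> sat V x p \/ sat V x q.
Proof.
split=> /= [h|[h h'|h _]//].
by case: (pselect (sat V x p)) => [|/h]; [left|right].
Qed.

Lemma sat_and V x p q : sat V x (And p q) <-> sat V x p /\ sat V x q.
Proof.
split=> /= [h|[hp hq] h]; last exact: h hp hq.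
by split; apply: contrapT => h'; apply: h => hp hq; apply: h'.
Qed.

Lemma sat_box V x a p : sat V x (Box a p) <-> forall y, acc a x y -> sat V y p.
Proof.
split=> /= [h y xy|h [y [xy]]]; last by apply; apply: h.
by apply: contrapT => py; apply: h; exists y.
Qed.

Lemma sat_subst V x s p :
  sat V x (substf s p) <-> sat (fun i => [set y | sat V y (s i)]) x p.
Proof.
elim: p x => [i||p IHp q IHq|a p IHp] x //=.
- by split=> h /IHp/h/IHq.
- by split=> -[y [xy /IHp py]]; exists y.
Qed.

Lemma sat_bool_eval V x p :
  bool_eval (fun q => `[<sat V x q>]) p <-> sat V x p.
Proof.
elim: p => [i||p IHp q IHq|a p IHp] /=; try by split=> /asboolP.
  by [].
split=> [/implyP h /IHp/h/IHq//|h].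
by apply/implyP => /IHp/h/IHq.
Qed.

Lemma frame_valid_normal : normal (frame_valid F : set (form A)).
Proof.
split.
- by move=> p tp V x; apply/sat_bool_eval; apply: tp.
- by move=> a V x /= [y []].
- move=> a V x; rewrite sat_imp sat_dia => -[y [xy /sat_or yp]].
  by apply/sat_or; case: yp => yp; [left|right]; exists y.
- by move=> p q pq hp V x; apply: pq (hp V x).
- by move=> s p hp V x; apply/sat_subst; apply: hp.
- by move=> a p q pq V x /= [y [xy yp]]; exists y; split=> //; apply: pq.
Qed.

Lemma sat_bigor V x (I : eqType) (r : seq I) (P : pred I) (G : I -> form A) :
  sat V x (\big[@Or A/Bot]_(i <- r | P i) G i) <->
  exists i, [/\ i \in r, P i & sat V x (G i)].
Proof.
elim: r => [|j r IHr]; first by rewrite big_nil; split=> [|[i []]].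
rewrite big_cons; split.
  case: ifP => Pj.
    by case/sat_or=> [h|/IHr[i [ir Pi hi]]]; [exists j|exists i];
       split=> //; rewrite inE ?eqxx ?ir ?orbT.
  by move/IHr=> [i [ir Pi hi]]; exists i; split=> //; rewrite inE ir orbT.
move=> [i []]; rewrite inE => /orP[/eqP->|ir] Pi hi.
  by rewrite Pi; apply/sat_or; left.
have h : sat V x (\big[@Or A/Bot]_(i <- r | P i) G i) by apply/IHr; exists i.
by case: ifP => // _; apply/sat_or; right.
Qed.

Lemma sat_bigand V x (I : eqType) (r : seq I) (P : pred I) (G : I -> form A) :
  sat V x (\big[@And A/Top]_(i <- r | P i) G i) <->
  forall i, i \in r -> P i -> sat V x (G i).
Proof.
elim: r => [|j r IHr]; first by rewrite big_nil; split=> // _ /=.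
rewrite big_cons; case: ifP => Pj; split.
- by case/sat_and=> hj /IHr hr i; rewrite inE => /orP[/eqP->//|/hr].
- move=> h; apply/sat_and; split; first by apply: h => //; rewrite inE eqxx.
  by apply/IHr => i ir; apply: h; rewrite inE ir orbT.
- by move/IHr=> h i; rewrite inE => /orP[/eqP->|/h//]; rewrite Pj.
- by move=> h; apply/IHr => i ir; apply: h; rewrite inE ir orbT.
Qed.

End Semantics.

(** * Subformula closure and least normal logics *)

Lemma mem_subforms (A : eqType) (p : form A) : p \in subforms p.
Proof. by case: p => *; rewrite /= inE eqxx. Qed.

Lemma subforms_Imp (A : eqType) (p a b : form A) :
  Imp a b \in subforms p -> (a \in subforms p) /\ (b \in subforms p).
Proof.
elim: p => [i||p IHp q IHq|c p IHp] //=; rewrite ?inE //=.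
- rewrite !mem_cat => /orP[/eqP[-> ->]|/orP[/IHp|/IHq] [-> ->]].
  + by rewrite !mem_subforms !orbT.
  + by rewrite !orbT.
  + by rewrite !orbT.
- by move=> /IHp[-> ->]; rewrite !orbT.
Qed.

Lemma subforms_Dia (A : eqType) (p : form A) a b :
  Dia a b \in subforms p -> b \in subforms p.
Proof.
elim: p => [i||p IHp q IHq|c p IHp] //=; rewrite ?inE //=.
- by rewrite !mem_cat => /orP[/IHp|/IHq] ->; rewrite !orbT.
- by move=> /orP[/eqP[_ ->]|/IHp ->]; rewrite ?mem_subforms orbT.
Qed.

Lemma smallest_normal A (Phi : set (form A)) :
  normal (smallest (@normal A) Phi).
Proof.
split.
- by move=> p tp M [nM _]; apply: normal_taut.
- by move=> a M [nM _]; apply: normal_dia_bot.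
- by move=> a M [nM _]; apply: normal_dia_or.
- by move=> p q pq hp M HM; apply: (normal_mp HM.1) (pq _ HM) (hp _ HM).
- by move=> s p hp M HM; apply: (normal_subst HM.1) (hp _ HM).
- by move=> a p q hp M HM; apply: (normal_mono HM.1) (hp _ HM).
Qed.

(** * The canonical model *)

Section Canonical.
Variables (A : Type) (L : set (form A)).
Hypothesis nL : normal L.
Implicit Types (T w : set (form A)) (p q r : form A).

Definition theory T :=
  L `<=` T /\ forall p q, T (Imp p q) -> T p -> T q.

Definition world w :=
  [/\ theory w, ~ w Bot & forall q, w q \/ w (Neg q)].

Lemma theory_taut T p : theory T -> tautology p -> T p.
Proof. by move=> [LT _] /(normal_taut nL)/LT. Qed.

(** This set is the theory generated by T and q, as in the deduction theorem. *)
Lemma theory_add T q : theory T -> theory [set r | T (Imp q r)].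
Proof.
move=> tT; split=> [r Lr|r s] /=.
  apply: (tT.2 _ _ _ (tT.1 _ Lr)); apply: theory_taut => //; taut.
move=> h h'; apply: (tT.2 _ _ _ h'); apply: (tT.2 _ _ _ h).
by apply: theory_taut => //; taut.
Qed.

(** A theory maximal among those that contain T and omit r is complete: if it omitted both q and its
    negation, it would contain the implications from each to r, hence r. *)
Lemma lindenbaum T r : theory T -> ~ T r ->
  exists w, [/\ world w, T `<=` w & ~ w r].
Proof.
move=> tT Tr.
pose P (X : set (form A)) := X = set0 \/ [/\ theory X, T `<=` X & ~ X r].
have [F FP Ftot|X [PX maxX]] := @Zorn_bigcup _ P.
  have [[Y FY [q Yq]]|F0] := pselect (exists2 Y, F Y & Y !=set0); last first.
    left; rewrite -subset0 => q [Y FY Yq]; case: F0; exists Y => //.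
    by exists q.
  have PF Z s : F Z -> Z s -> [/\ theory Z, T `<=` Z & ~ Z r].
    by move=> FZ Zs; case: (FP _ FZ) => // Z0; rewrite Z0 in Zs.
  right; split; last by move=> [Z FZ Zr]; have [_ _] := PF _ _ FZ Zr; apply.
    split=> [s Ls|s t [Z FZ Zst] [Z' FZ' Zs]].
      by exists Y => //; have [tY _ _] := PF _ _ FY Yq; apply: tY.1.
    have [ZZ'|Z'Z] := Ftot _ _ FZ FZ'.
      exists Z' => //; have [tZ _ _] := PF _ _ FZ' Zs.
      by apply: (tZ.2 s) => //; apply: ZZ'.
    exists Z => //; have [tZ _ _] := PF _ _ FZ Zst.
    by apply: (tZ.2 s) => //; apply: Z'Z.
  by move=> s Ts; exists Y => //; have [_ TY _] := PF _ _ FY Yq; apply: TY.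
have PT : P T by right; split.
have tTop : T Top by apply: theory_taut => //; taut.
have [tX TX Xr] : [/\ theory X, T `<=` X & ~ X r].
  case: PX => // X0; exfalso; apply: (maxX T) => //; rewrite X0.
  by split=> // /(_ _ tTop).
(* Otherwise the theory generated by X and q would still omit r, against maximality. *)
have max q : ~ X q -> X (Imp q r).
  move=> Xq; apply: contrapT => Xqr.
  apply: (maxX [set s | X (Imp q s)]).
    split=> [s Xs|sub].
      apply: (tX.2 _ _ _ Xs); apply: theory_taut => //; taut.
    apply: Xq; apply: sub; apply: (theory_taut tX); taut.
  right; split=> //; first exact: theory_add.
  move=> s Ts /=; apply: (tX.2 _ _ _ (TX _ Ts)); apply: theory_taut => //; taut.
exists X; split=> //; split=> //.
  move=> XB; apply: Xr; apply: (tX.2 _ _ _ XB).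
  by apply: theory_taut => //; taut.
move=> q; apply: contrapT => /not_orP[/max Xq /max Xnq]; apply: Xr.
apply: (tX.2 _ _ _ Xq); apply: (tX.2 _ _ _ Xnq); apply: theory_taut => //; taut.
Qed.

Section World.
Variables (w : set (form A)) (ww : world w).

Lemma world_L p : L p -> w p.
Proof. by case: ww => -[]; auto. Qed.

Lemma world_imp p q : w (Imp p q) <-> (w p -> w q).
Proof.
case: ww => tw wB wN; split; first exact: tw.2.
move=> h; case: (wN p) => [/h wq|wNp].
  apply: (tw.2 _ _ _ wq); apply: theory_taut => //; taut.
apply: (tw.2 _ _ _ wNp); apply: theory_taut => //; taut.
Qed.

Lemma world_bot : ~ w Bot.
Proof. by case: ww. Qed.

Lemma world_neg p : w (Neg p) <-> ~ w p.
Proof. by split=> [/world_imp h /h/world_bot|h]//; apply/world_imp. Qed.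

Lemma world_or p q : w (Or p q) <-> w p \/ w q.
Proof.
split=> [/world_imp h|[h|h]]; last by apply/world_imp.
  by case: (pselect (w p)) => [|/world_neg/h]; [left|right].
by apply/world_imp => /world_neg.
Qed.

Lemma world_and p q : w (And p q) <-> w p /\ w q.
Proof.
split=> [/world_neg h|[wp wq]]; last first.
  by apply/world_neg => /world_imp/(_ wp)/world_neg.
by split; apply: contrapT => h'; apply: h; apply/world_imp => // _;
   apply/world_neg.
Qed.

Lemma world_dia_mono a p q : L (Imp p q) -> w (Dia a p) -> w (Dia a q).
Proof. by move=> /(normal_mono nL a)/world_L/world_imp. Qed.

Lemma world_dia_or a p q : w (Dia a (Or p q)) -> w (Dia a p) \/ w (Dia a q).
Proof.
have /world_L/world_imp h := normal_subst nL
  (fun i => if i is 0 then p else q) (normal_dia_or nL a).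
by move=> /h/world_or.
Qed.

Lemma world_dia_bot a : ~ w (Dia a Bot).
Proof. by apply/world_neg/world_L; apply: normal_dia_bot. Qed.

End World.

Definition canrel (a : A) (w u : set (form A)) := forall r, u r -> w (Dia a r).

(** T collects the formulas r for which w makes the implication from q to r necessary. It is
    consistent because w contains [Dia a q], and every world above it contains q and is an
    a-successor of w. *)
Lemma canrel_exists a w q : world w -> w (Dia a q) ->
  exists u, [/\ world u, canrel a w u & u q].
Proof.
move=> ww wq; pose T := [set r | ~ w (Dia a (And q (Neg r)))].
have tT : theory T.
  split=> [r Lr|r s] /=.
    have : ~ w (Dia a Bot) by apply: world_dia_bot.
    apply: contra_not; apply: world_dia_mono => //; apply: (normal_mp nL _ Lr).
    by apply: normal_taut => //; taut.
  rewrite /T /= => h1 h2 h.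
  suff [] :
    w (Dia a (And q (Neg (Imp r s)))) \/ w (Dia a (And q (Neg r))) by [].
  apply: world_dia_or => //; apply: world_dia_mono h => //.
  by apply: normal_taut => //; taut.
have TB : ~ T Bot.
  apply; apply: world_dia_mono wq => //.
  by apply: normal_taut => //; taut.
have [u [wu Tu uB]] := lindenbaum tT TB.
exists u; split=> //.
  move=> r ur; apply: contrapT => wr.
  suff /Tu/(world_neg wu) : T (Neg r) by [].
  apply: contra_not wr; apply: world_dia_mono => //.
  by apply: normal_taut => //; taut.
apply: Tu.
have : ~ w (Dia a Bot) by apply: world_dia_bot.
apply: contra_not; apply: world_dia_mono => //.
by apply: normal_taut => //; taut.
Qed.

Definition canonical_frame (C : set (set (form A))) : frame A :=
  @Frame A {w | world w /\ C w} (fun a x y => canrel a (sval x) (sval y)).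

Definition canval C (i : nat) : set (canonical_frame C) :=
  [set x | sval x (Var i)].

(** Closure of C under the canonical relations keeps the witnesses of diamonds inside the
    subframe. *)
Lemma truth (C : set (set (form A))) :
  (forall a w u, world w -> world u -> C w -> canrel a w u -> C u) ->
  forall p (w : canonical_frame C), sat (@canval C) w p <-> sval w p.
Proof.
move=> closedC; elim=> [i||p IHp q IHq|a p IHp] w //=; have [ww Cw] := svalP w.
- by split=> // /(world_bot ww).
- split=> [h|/(world_imp ww) h /IHp/h/IHq//].
  by apply/(world_imp ww) => /IHp/h/IHq.
- split=> [[u [wu /IHp/wu]]//|wp].
  have [u [wu wau up]] := canrel_exists ww wp.
  have Cu := closedC _ _ _ ww wu Cw wau.
  by exists (exist _ u (conj wu Cu)); split=> //; apply/IHp.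
Qed.

End Canonical.

(** * Frames in which distinct points are D-related *)

(** D contains inequality but may also have reflexive points; [ExD] and [AllD] still quantify over
    all points. *)
Record universal (F : frame bool) : Prop := Universal {
  universal_total : forall x y : F, x = y \/ acc true x y;
  universal_symD : forall x y : F, acc true x y -> acc true y x;
  universal_symR : forall x y : F, acc false x y -> acc false y x
}.

Definition connected (F : frame bool) :=
  forall S : set F, S !=set0 -> (~` S) !=set0 ->
  exists y z, [/\ acc false y z, S y & ~ S z].

(** The two points may coincide, so an R-reflexive point excludes every proper colouring. *)
Definition uncolorable k (F : frame bool) :=
  forall c : F -> 'I_k, exists y z, acc false y z /\ c y = c z.

Lemma sat_of_unimodal (F : frame bool) V (x : F) (p : form unit) :
  sat V x (of_unimodal p) <->
  sat (F := @Frame unit F (fun _ => acc false)) V x p.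
Proof.
elim: p x => [i||p IHp q IHq|a p IHp] x //=.
- by split=> h /IHp/h/IHq.
- by split=> -[y [xy /IHp py]]; exists y.
Qed.

Section Universal.
Variables (F : frame bool) (univF : universal F).
Implicit Types (V : nat -> set F) (x : F) (p : bform).

Lemma sat_ex V x p : sat V x (ExD p) <-> exists y, sat V y p.
Proof.
rewrite /ExD sat_or; split=> [[[y [_ yp]]|xp]|[y yp]].
- by exists y.
- by exists x.
- have [->|xy] := universal_total univF x y; first by right.
  by left; exists y.
Qed.

Lemma sat_all V x p : sat V x (AllD p) <-> forall y, sat V y p.
Proof.
rewrite /AllD sat_and /BoxD sat_box; split=> [[Dp xp] y|h]; last by split.
by have [<-|xy] := universal_total univF x y; last exact: Dp.
Qed.

Lemma sat_con V x : sat V x Con <->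
  (V 0 !=set0 -> (~` V 0) !=set0 ->
   exists y z, [/\ acc false y z, V 0 y & ~ V 0 z]).
Proof.
rewrite /Con sat_imp sat_and !sat_ex; split.
  move=> h [y V0y] [z V0z]; case: h; first by split; [exists y|exists z].
  move=> u /sat_and[V0u [v [uv V0v]]].
  by exists u, v.
move=> h [[y V0y] [z V0z]].
have [|u [v [uv V0u V0v]]] := h _ (ex_intro _ z V0z); first by exists y.
by exists u; apply/sat_and; split=> //; exists v.
Qed.

Lemma sat_chi k V x : sat V x (Chi k) <->
  ((forall y, exists i : 'I_k, V i y /\ forall j : 'I_k, j != i -> ~ V j y) ->
   exists (i : 'I_k) y z, [/\ acc false y z, V i y & V i z]).
Proof.
rewrite /Chi sat_imp sat_all sat_ex; split=> h.
  move=> hc; case: h => [y|y].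
    have [i [Viy hi]] := hc y; apply/sat_bigor; exists i.
    split; rewrite ?mem_index_enum //.
    by apply/sat_and; split=> //; apply/sat_bigand => j _ ji; apply: hi.
  move=> /sat_bigor[i [_ _ /sat_and[Viy [z [yz Viz]]]]].
  by exists i, y, z.
move=> hc; case: h => [y|i [y [z [yz Viy Viz]]]].
  have /sat_bigor[i [_ _ /sat_and[Viy /sat_bigand hi]]] := hc y.
  exists i; split=> // j ji; apply: hi => //; exact: mem_index_enum.
exists y; apply/sat_bigor; exists i; split; rewrite ?mem_index_enum //.
by apply/sat_and; split=> //; exists z.
Qed.

Lemma universal_KBneq : frame_of_logic F KBneq.
Proof.
apply: smallest_sub; first exact: frame_valid_normal.
move=> p [[q KBq <-] V x|].
  apply/sat_of_unimodal.
  move: q KBq V x.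
  (* [KB] is itself a least normal logic, so minimality is used a second time, on the reduct to
     R. *)
  apply: (@smallest_sub _ _ _ (frame_valid (@Frame unit F (fun=> acc false)))).
    exact: frame_valid_normal.
  move=> q -> V x; rewrite sat_imp => Vx; apply/sat_box => y xy.
  by exists x; split=> //; apply: (universal_symR univF).
case=> [[->|->]|->] V x; rewrite sat_imp.
- move=> Vx; apply/sat_box => y xy.
  by exists x; split=> //; apply: (universal_symD univF).
- by move=> [y [_ [z [_ Vz]]]]; apply/sat_ex; exists z.
- by move=> [y [_ Vy]]; apply/sat_ex; exists y.
Qed.

Lemma frame_of_Chi_Con k : connected F -> uncolorable k F ->
  frame_of_logic F (log_plus KBneq [set Chi k; Con]).
Proof.
move=> conF uncF; apply: smallest_sub; first exact: frame_valid_normal.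
move=> p [/universal_KBneq//|[->|->]] V x; last by apply/sat_con; apply: conF.
apply/sat_chi => /choice[c hc].
have [y [z [yz cyz]]] := uncF c; exists (c y), y, z; split=> //.
  by case: (hc y).
by rewrite cyz; case: (hc z).
Qed.

End Universal.

Lemma KBneq_sub_log_plus Phi : KBneq `<=` log_plus KBneq Phi.
Proof. by apply: sub_smallest => p; left. Qed.

Lemma canonical_countermodel Phi p : ~ log_plus KBneq Phi p ->
  exists (F : frame bool) (V : nat -> set F) (x : F),
  [/\ universal F, forall q y, log_plus KBneq Phi q -> sat V y q & ~ sat V x p].
Proof.
set L := log_plus KBneq Phi => Lp.
have nL : normal L by exact: smallest_normal.
have KL : KBneq `<=` L by exact: KBneq_sub_log_plus.
have KBax q : (of_unimodal @` KB) q -> L q.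
  by move=> h; apply: KL; apply: sub_gen_smallest; left.
have axs q : L (Imp q (BoxD (DiaD q))) /\ L (Imp (DiaD (DiaD q)) (ExD q)) /\
  L (Imp (DiaR q) (ExD q)) /\ L (Imp q (Box false (DiaR q))).
  have inst r : L r -> L (substf (fun _ => q) r) by apply: normal_subst.
  split; last split; last split.
  - apply: (inst (Imp (Var 0) (BoxD (DiaD (Var 0))))).
    by apply: KL; apply: sub_gen_smallest; right; left; left.
  - apply: (inst (Imp (DiaD (DiaD (Var 0))) (ExD (Var 0)))).
    by apply: KL; apply: sub_gen_smallest; right; left; right.
  - apply: (inst (Imp (DiaR (Var 0)) (ExD (Var 0)))).
    by apply: KL; apply: sub_gen_smallest; right; right.
  - apply: (inst (Imp (Var 0) (Box false (DiaR (Var 0))))).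
    apply: KBax; exists (Imp (Var 0) (Box tt (Dia tt (Var 0)))) => //.
    exact: sub_gen_smallest.
have wE w q : world L w -> w (ExD q) <-> w (DiaD q) \/ w q.
  by move=> ww; apply: (world_or nL ww).
have sym a w u : world L w -> world L u -> canrel a w u -> canrel a u w.
  move=> ww wu wau q wq; apply: contrapT => uq.
  have : w (Box a (Dia a q)).
    by apply: (world_imp nL ww _ _).1 wq; apply: (world_L ww);
       case: a {wau uq}; have [? [_ [_ ?]]] := axs q.
  by move/(world_neg nL ww); apply; apply: wau; apply/(world_neg nL wu).
(* If some r in u has no D-successor according to w, then for every s in u the formula
   [ExD (And r s)] can only be witnessed by w itself. Hence u is included in w, and complete worlds
   so related are equal. *)
have eqor w u : world L w -> world L u ->
    (forall q, u q -> w (ExD q)) -> w = u \/ canrel true w u.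
  move=> ww wu h; apply: contrapT.
  move=> /not_orP[wNu /existsNP[r /not_implyP[ur wr]]].
  have uw : u `<=` w.
    move=> s us; have : w (ExD (And r s)) by apply: h; apply/(world_and nL wu).
    case/(wE _ _ ww) => [|/(world_and nL ww)[]//].
    move=> h'; case: wr; apply: (world_dia_mono nL ww) h'.
    by apply: normal_taut => //; taut.
  apply: wNu; apply/seteqP; split=> // s ws; apply: contrapT.
  by move=> /(world_neg nL wu)/uw/(world_neg nL ww).
have trans w u v : world L w -> world L u -> world L v ->
    canrel true w u -> canrel true u v -> w = v \/ canrel true w v.
  move=> ww wu wv wu' uv; apply: eqor => // q vq.
  by apply: (world_imp nL ww _ _).1 (wu' _ (uv _ vq)); apply: (world_L ww);
     have [_ []] := axs q.
have RD w u : world L w -> world L u -> canrel false w u ->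
    w = u \/ canrel true w u.
  move=> ww wu wu'; apply: eqor => // q uq.
  by apply: (world_imp nL ww _ _).1 (wu' _ uq); apply: (world_L ww);
     have [_ [_ []]] := axs q.
have tL : theory L L by split=> //; apply: normal_mp.
have [w0 [ww0 _ w0p]] := lindenbaum nL tL Lp.
(* Members of C are equal or D-related to one another by passing through w0, with symmetry and
   pseudo-transitivity. *)
pose C := [set u | w0 = u \/ canrel true w0 u].
have closedC a w u : world L w -> world L u -> C w -> canrel a w u -> C u.
  move=> ww wu Cw wau.
  have [<-//|wDu] : w = u \/ canrel true w u.
    by case: a wau => [|/(RD _ _ ww wu)//]; right.
  case: Cw => [w0w|w0w]; first by right; rewrite w0w.
  exact: trans w0w wDu.
pose x0 : canonical_frame L C :=
  exist (fun w => world L w /\ C w) w0 (conj ww0 (or_introl erefl)).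
exists (canonical_frame L C), (@canval _ L C), x0; split.
- split.
  + move=> [w [ww Cw]] [u [wu Cu]] /=.
    have [wu'|wu'] : w = u \/ canrel true w u; last by right.
      case: Cw => [<-//|w0w]; case: Cu => [<-|w0u]; first by right; apply: sym.
      by apply: (trans _ w0) => //; apply: sym.
    by left; apply: eq_exist.
  + by move=> [w [ww Cw]] [u [wu Cu]] /=; apply: sym.
  + by move=> [w [ww Cw]] [u [wu Cu]] /=; apply: sym.
- move=> q y Lq; apply/(truth nL closedC); have [wy _] := svalP y.
  exact: (world_L wy).
- by move/(truth nL closedC).
Qed.

(** * Filtration *)

Section Filtration.
Variables (F : frame bool) (V : nat -> set F) (p : bform).
Hypothesis univF : universal F.

Local Notation n := (num_subforms p).
Local Notation sub i := (nth Bot (undup (subforms p)) i).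

Definition type_of (y : F) : {set 'I_n} :=
  [set i : 'I_n | `[< sat V y (sub i) >]].

Definition quotient : finType :=
  {T : {set 'I_n} | `[< exists y, type_of y = T >]}.

Definition qclass (y : F) : quotient :=
  exist _ (type_of y) (asboolT (ex_intro _ y erefl)).

(** The least relations that make [qclass] a homomorphism; symmetry passes to them. *)
Definition qrel (a : bool) (T U : quotient) :=
  exists y z, [/\ qclass y = T, qclass z = U & acc a y z].

Definition qval (i : nat) : set (Frame qrel) :=
  [set T | exists y, qclass y = T /\ V i y].

Lemma qclass_surj (T : quotient) : exists y, qclass y = T.
Proof. by case: T => T /[dup] /asboolP[y yT] h; exists y; apply: val_inj. Qed.

Lemma qclass_sat y z q : qclass y = qclass z -> q \in subforms p ->
  sat V y q <-> sat V z q.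
Proof.
move=> [] /setP yz; rewrite -mem_undup => qp.
have qn : index q (undup (subforms p)) < n by rewrite index_mem.
have := yz (Ordinal qn); rewrite !inE /= nth_index // => E.
by split=> /asboolP; rewrite (E, =^~ E) => /asboolP.
Qed.

(** In the diamond case a related pair of classes has related representatives z and u; truth of q
    passes from the class of u to u, and truth of the diamond from z to y, both being subformulas of
    p. *)
Lemma filtration_truth q y : q \in subforms p ->
  sat qval (qclass y) q <-> sat V y q.
Proof.
elim: q y => [i||q IHq r IHr|a q IHq] y sq //=.
- split=> [[z [zy Viz]]|Viy]; last by exists y.
  by apply/(qclass_sat zy sq : V i z <-> V i y).
- have [sq1 sr1] := subforms_Imp sq.
  by split=> h /(IHq _ sq1)/h/(IHr _ sr1).
- have sq1 := subforms_Dia sq.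
  split=> [[T [[z [u [zy <- zu]]] /(IHq _ sq1) uq]]|[z [yz zq]]].
    by apply/(qclass_sat zy sq); exists u.
  by exists (qclass z); split; [exists y, z|apply/IHq].
Qed.

Lemma quotient_universal : universal (Frame qrel).
Proof.
split=> [T U|T U [y [z [yT zU yz]]]|T U [y [z [yT zU yz]]]].
- have [y <-] := qclass_surj T; have [z <-] := qclass_surj U.
  have [->|yz] := universal_total univF y z; first by left.
  by right; exists y, z.
- by exists z, y; split=> //; apply: (universal_symD univF).
- by exists z, y; split=> //; apply: (universal_symR univF).
Qed.

(** A disjunctive normal form defining the preimage of S in the original model, so that axiom
    instances can speak about any set of classes. *)
Definition describe (S : set quotient) : bform :=
  \big[@Or bool/Bot]_(T <- enum quotient | `[< S T >])
    \big[@And bool/Top]_(i <- enum 'I_n)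
      (if i \in val T then sub i else Neg (sub i)).

Lemma sat_describe S y : sat V y (describe S) <-> S (qclass y).
Proof.
split=> [/sat_bigor[T [_ /asboolP ST /sat_bigand h]]|Sy].
  suff <- : T = qclass y by [].
  apply: val_inj; apply/setP => i; rewrite inE; apply/idP/asboolP => iT.
    by have := h i (mem_enum _ i) isT; rewrite iT.
  by apply/negPn/negP => iNT; have := h i (mem_enum _ i) isT;
     rewrite (negPf iNT); apply.
apply/sat_bigor; exists (qclass y); split; rewrite ?mem_enum //.
  exact/asboolP.
apply/sat_bigand => i _ _; case: ifPn; rewrite inE => /asboolP //.
Qed.

Lemma card_quotient : #|quotient| <= 2 ^ n.
Proof.
rewrite card_sig; apply: leq_trans (max_card _) _.
by rewrite -cardsT -powersetT card_powerset cardsT card_ord.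
Qed.

(** The instance of [Con] for the preimage of S yields an edge leaving that preimage, and its image
    is an edge leaving S. *)
Lemma quotient_connected : (forall s y, sat V y (substf s Con)) ->
  connected (Frame qrel).
Proof.
move=> conV S [T ST] [U SU].
have [y yT] := qclass_surj T; have [z zU] := qclass_surj U.
have := conV (fun=> describe S) y; rewrite sat_subst (sat_con univF) => h.
case: h => [||u [v [uv /sat_describe Su Sv]]].
- by exists y; apply/sat_describe; rewrite yT.
- by exists z => /sat_describe; rewrite zU.
exists (qclass u), (qclass v); split=> //; first by exists u, v.
by move=> ?; apply: Sv; apply/sat_describe.
Qed.

(** The preimages of the colour classes partition the model, so the instance of [Chi k] for their
    definitions gives a monochromatic edge. A point of F is required, because the empty frame has a
    proper colouring. *)
Lemma quotient_uncolorable k : F -> (forall s y, sat V y (substf s (Chi k))) ->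
  uncolorable k (Frame qrel).
Proof.
move=> x chiV c.
have := chiV (fun i => describe [set T | c T = i :> nat]) x.
rewrite sat_subst (sat_chi univF) => h.
case: h => [y|i [y [z [yz /sat_describe/= yi /sat_describe/= zi]]]].
  exists (c (qclass y)); split; first exact/sat_describe.
  by move=> j ji /sat_describe/= /ord_inj E; rewrite E eqxx in ji.
exists (qclass y), (qclass z); split; first by exists y, z.
by apply: ord_inj; rewrite yi zi.
Qed.

End Filtration.

(** * Finite countermodels *)

Lemma finite_countermodel k p : ~ log_plus KBneq [set Chi k; Con] p ->
  exists (X : finType) (R : bool -> X -> X -> Prop),
  [/\ #|X| <= 2 ^ num_subforms p,
      [/\ universal (Frame R), connected (Frame R) & uncolorable k (Frame R)]
    & falsified (Frame R) p].
Proof.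
move=> /canonical_countermodel[F [V [x [univF LV xp]]]].
have nL := smallest_normal (KBneq `|` [set Chi k; Con]).
exists (quotient V p), (@qrel F V p); split; first exact: card_quotient.
  split; first exact: quotient_universal.
    apply: quotient_connected => // s y; apply: LV; apply: (normal_subst nL).
    by apply: sub_gen_smallest; right; right.
  apply: quotient_uncolorable => // s y; apply: LV; apply: (normal_subst nL).
  by apply: sub_gen_smallest; right; left.
exists (@qval F V p), (qclass V p x).
by apply: contra_not xp => /filtration_truth; apply; apply: mem_subforms.
Qed.

(** The premise of [Chi 0] is [AllD Bot], which its second conjunct refutes propositionally. *)
Lemma log_plus_Chi0 :
  log_plus KBneq [set Con] = log_plus KBneq [set Chi 0; Con].
Proof.
apply/seteqP; split.
  apply: smallest_sub; first exact: smallest_normal.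
  move=> p [?|->]; apply: sub_gen_smallest; [by left|by right; right].
apply: smallest_sub; first exact: smallest_normal.
move=> p [?|[->|->]]; [by apply: sub_gen_smallest; left| |].
  apply: (normal_taut (smallest_normal _)).
  by rewrite /Chi !big_ord0; taut.
by apply: sub_gen_smallest; right.
Qed.

(** * Recursiveness of bounded arithmetic *)

(* Environments are sequences read with default value 0, so that one function
   of sequences represents an n-ary function for each n. *)
Definition recseq (f : seq nat -> nat) :=
  forall n, recursive (fun v : n.-tuple nat => f v).

Lemma recursive_ext n (f g : n.-tuple nat -> nat) :
  f =1 g -> recursive f -> recursive g.
Proof. by move=> /funext->. Qed.

Lemma recseq_ext f g : f =1 g -> recseq f -> recseq g.
Proof. by move=> /funext->. Qed.

Lemma recseq_nth i : recseq (fun e => nth 0 e i).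
Proof.
move=> n; have [ltin|leni] := ltnP i n.
  by apply: recursive_ext (rec_proj (Ordinal ltin)) => v; rewrite (tnth_nth 0).
apply: recursive_ext (rec_zero n) => v.
by rewrite nth_default // size_tuple.
Qed.

(** The length of s e may depend only on that of e, because recursive functions have a fixed
    arity. *)
Lemma recseq_comp f (s : seq nat -> seq nat) (d : nat -> nat) :
  (forall e, size (s e) = d (size e)) ->
  (forall i, recseq (fun e => nth 0 (s e) i)) ->
  recseq f -> recseq (f \o s).
Proof.
move=> sizes recs recf n.
apply: (rec_comp (recf (d n)) (fun i : 'I_(d n) => recs i n)) => v /=.
congr f; apply: (@eq_from_nth _ 0).
  by rewrite sizes !size_tuple ?card_ord.
move=> i; rewrite sizes size_tuple => ltid.
have := tnth_mktuple (fun j : 'I_(d n) => nth 0 (s v) j) (Ordinal ltid).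
by rewrite (tnth_nth 0).
Qed.

Lemma recseq_succ f : recseq f -> recseq (fun e => (f e).+1).
Proof.
move=> recf n; apply: (rec_comp rec_succ (fun _ : 'I_1 => recf n)) => v.
by rewrite (tnth_mktuple _ ord0 : thead _ = _).
Qed.

Lemma recseq_num c : recseq (fun=> c).
Proof.
by elim: c => [n|c IHc]; [exact: rec_zero|exact: (recseq_succ IHc)].
Qed.

(** The auxiliary h recurses on the head of its environment, which is then instantiated by b e. In
    the step g, index 0 is the counter, index 1 the previous value, and e begins at index 2. *)
Lemma recseq_natrec f g b : recseq f -> recseq g -> recseq b ->
  recseq (fun e =>
    nat_rect (fun=> nat) (f e) (fun y r => g [:: y, r & e]) (b e)).
Proof.
move=> recf recg recb.
pose h e := nat_rect (fun=> nat) (f (behead e))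
              (fun y r => g [:: y, r & behead e]) (nth 0 e 0).
have rech n : recursive (fun v : n.+1.-tuple nat => h v).
  by apply: (rec_primrec (recf n) (recg n.+2)).
move=> n.
apply: (@rec_comp _ _ _ (fun i v => nth 0 (b (tval v) :: v) (val i)) _ (rech n)).
  by case=> -[|i] lti /=; [apply: recb|apply: recseq_nth].
move=> v; rewrite -[LHS]/(h (b v :: v)); congr h.
apply: (@eq_from_nth _ 0); first by rewrite /= !size_tuple ?card_ord.
rewrite /= size_tuple => i lti.
have := tnth_mktuple (fun j : 'I_n.+1 => nth 0 (b v :: v) j) (Ordinal lti).
by rewrite (tnth_nth 0).
Qed.

Lemma recseq_drop k f : recseq f -> recseq (fun e => f (drop k e)).
Proof.
apply: (@recseq_comp _ _ (subn^~ k)) => [e|i]; first by rewrite size_drop.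
by apply: recseq_ext (recseq_nth (k + i)) => e; rewrite nth_drop.
Qed.

(** Hides the previous value, so that the body of a bounded quantifier can be evaluated inside a
    recursion step. *)
Lemma recseq_skip f : recseq f -> recseq (fun e => f (nth 0 e 0 :: drop 2 e)).
Proof.
apply: (@recseq_comp _ _ (fun m => (m - 2).+1)) => [e|[|i]] /=.
- by rewrite size_drop.
- exact: recseq_nth.
- by apply: recseq_ext (recseq_nth (2 + i)) => e; rewrite nth_drop.
Qed.

Lemma recseq_if c f g : recseq c -> recseq f -> recseq g ->
  recseq (fun e => if c e is 0 then f e else g e).
Proof.
move=> recc recf recg.
apply: recseq_ext (recseq_natrec recf (recseq_drop 2 recg) recc) => e /=.
by case: (c e) => //=; rewrite drop0.
Qed.

Lemma recseq_add f g : recseq f -> recseq g -> recseq (fun e => f e + g e).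
Proof.
move=> recf recg.
apply: recseq_ext (recseq_natrec recf (recseq_succ (recseq_nth 1)) recg) => e /=.
by elim: (g e) => [|m /= ->]; rewrite ?addn0 ?addnS.
Qed.

Lemma recseq_mul f g : recseq f -> recseq g -> recseq (fun e => f e * g e).
Proof.
move=> recf recg; apply: recseq_ext (recseq_natrec (recseq_num 0)
  (recseq_add (recseq_nth 1) (recseq_drop 2 recf)) recg) => e /=.
by elim: (g e) => [|m /= ->]; rewrite ?muln0 // drop0 mulnS addnC.
Qed.

Lemma recseq_exp2 f : recseq f -> recseq (fun e => 2 ^ f e).
Proof.
move=> recf; apply: recseq_ext (recseq_natrec (recseq_num 1)
  (recseq_add (recseq_nth 1) (recseq_nth 1)) recf) => e /=.
by elim: (f e) => [|m /= ->]; rewrite // expnS mul2n addnn.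
Qed.

Lemma recseq_sub f g : recseq f -> recseq g -> recseq (fun e => f e - g e).
Proof.
move=> recf recg.
have recpred h : recseq h -> recseq (fun e => (h e).-1).
  move=> rech; apply: recseq_ext (recseq_natrec (recseq_num 0)
    (recseq_nth 0) rech) => e /=.
  by case: (h e).
apply: recseq_ext (recseq_natrec recf (recpred _ (recseq_nth 1)) recg) => e /=.
by elim: (g e) => [|m /= ->]; rewrite ?subn0 ?subnS.
Qed.

Lemma recseq_odd f : recseq f -> recseq (fun e => odd (f e) : nat).
Proof.
move=> recf; apply: recseq_ext (recseq_natrec (recseq_num 0)
  (recseq_if (recseq_nth 1) (recseq_num 1) (recseq_num 0)) recf) => e /=.
by elim: (f e) => [|m /= ->] //; case: (odd m).
Qed.

Lemma recseq_half f : recseq f -> recseq (fun e => (f e)./2).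
Proof.
move=> recf; apply: recseq_ext (recseq_natrec (recseq_num 0)
  (recseq_add (recseq_odd (recseq_nth 0)) (recseq_nth 1)) recf) => e /=.
by elim: (f e) => [|m /= ->] //; rewrite uphalf_half.
Qed.

(** * Sets and relations coded by bits, and bounded arithmetic *)

Definition bit (c i : nat) : bool := odd (iter i half c).

Lemma recseq_bit f g : recseq f -> recseq g ->
  recseq (fun e => bit (f e) (g e) : nat).
Proof.
move=> recf recg; apply: recseq_odd.
apply: recseq_ext (recseq_natrec recf (recseq_half (recseq_nth 1)) recg) => e /=.
by elim: (g e) => [|m /= ->].
Qed.

(** Comprehension on an initial segment: it turns quantifiers over finite sets into bounded
    quantifiers over numbers. *)
Lemma exists_bits m (P : nat -> Prop) :
  exists2 c, c < 2 ^ m & forall i, i < m -> bit c i <-> P i.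
Proof.
elim: m P => [|m IHm] P; first by exists 0.
have [c ltc cP] := IHm (fun i => P i.+1).
exists (`[<P 0>] + c.*2).
  rewrite expnS mul2n -ltn_half_double; apply: leq_ltn_trans ltc.
  by rewrite -ltnS ltn_half_double; case: `[<_>].
case=> [_|i lti]; rewrite /bit.
  by rewrite /= oddD odd_double addbF oddb; split=> /asboolP.
by rewrite iterSr half_bit_double; apply: cP.
Qed.

Lemma exists_bits2 m k (P : nat -> nat -> Prop) :
  exists2 c, c < 2 ^ (m * k) &
  forall i j, i < m -> j < k -> bit c (i * k + j) <-> P i j.
Proof.
have [c ltc cP] := exists_bits (m * k) (fun i => P (i %/ k) (i %% k)).
exists c => // i j lti ltj.
have k0 : 0 < k by apply: leq_ltn_trans ltj.
have -> : P i j = P ((i * k + j) %/ k) ((i * k + j) %% k).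
  by rewrite divnMDl // modnMDl divn_small // modn_small // addn0.
by apply: cP; apply: (@leq_trans (i.+1 * k));
  [rewrite mulSn addnC ltn_add2r|rewrite leq_mul2r lti orbT].
Qed.

(* Bounded arithmetic with exponentiation and bit extraction, in de Bruijn
   notation; [Code t u] is the code of a sequence with head t and tail u. *)
Inductive term :=
| Idx of nat
| Cst of nat
| Succ of term
| Add of term & term
| Mul of term & term
| Exp2 of term
| Code of term & term.

Inductive bounded :=
| Less of term & term
| Bit of term & term
| False_
| Impl of bounded & bounded
| Conj of bounded & bounded
| All of term & bounded
| Ex of term & bounded.

(** The clause for [Code] is the recursion equation of [CodeSeq.code], with 0 for the empty
    sequence, so codes of formulas are values of terms by conversion. *)
Fixpoint value (e : seq nat) (t : term) : nat :=
  match t with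
  | Idx i => nth 0 e i
  | Cst c => c
  | Succ t => (value e t).+1
  | Add t u => value e t + value e u
  | Mul t u => value e t * value e u
  | Exp2 t => 2 ^ value e t
  | Code t u => 2 ^ value e t * (value e u).*2.+1
  end.

Fixpoint holds (e : seq nat) (b : bounded) : Prop :=
  match b with
  | Less t u => value e t < value e u
  | Bit t u => bit (value e t) (value e u)
  | False_ => False
  | Impl b c => holds e b -> holds e c
  | Conj b c => holds e b /\ holds e c
  | All t b => forall y, y < value e t -> holds (y :: e) b
  | Ex t b => exists2 y, y < value e t & holds (y :: e) b
  end.

Lemma recseq_value t : recseq (value^~ t).
Proof.
elim: t => [i|c|t IHt|t IHt u IHu|t IHt u IHu|t IHt|t IHt u IHu] /=.
- exact: recseq_nth.
- exact: recseq_num.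
- exact: recseq_succ.
- exact: recseq_add.
- exact: recseq_mul.
- exact: recseq_exp2.
- apply: recseq_mul (recseq_exp2 IHt) _.
  apply: recseq_ext (recseq_succ (recseq_add IHu IHu)) => e.
  by rewrite addnn.
Qed.

Lemma recseq_holds b : recseq (fun e => `[<holds e b>] : nat).
Proof.
elim: b => [t u|t u||b IHb c IHc|b IHb c IHc|t b IHb|t b IHb] /=.
- apply: recseq_ext (recseq_if (recseq_sub (recseq_value u) (recseq_value t))
    (recseq_num 0) (recseq_num 1)) => e.
  rewrite asboolb ltnNge -subn_eq0.
  by case: (_ - _).
- apply: recseq_ext (recseq_bit (recseq_value t) (recseq_value u)) => e.
  by rewrite asboolb.
- by apply: recseq_ext (recseq_num 0) => e; rewrite asboolF.
- apply: recseq_ext (recseq_if IHb (recseq_num 1) IHc) => e.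
  by rewrite asbool_imply; case: `[<holds e b>].
- apply: recseq_ext (recseq_if IHb (recseq_num 0) IHc) => e.
  by rewrite asbool_and; case: `[<holds e b>].
(* The accumulator is the truth value over all numbers below the counter: once 0 it stays 0, and
   otherwise the body is tested at the counter. The existential case is dual. *)
- apply: recseq_ext (recseq_natrec (recseq_num 1) (recseq_if (recseq_nth 1)
    (recseq_num 0) (recseq_skip IHb)) (recseq_value t)) => e /=.
  elim: (value e t) => [|m /= ->]; first by rewrite asboolT.
  rewrite /= ?drop0; case: asboolP => h /=; case: asboolP => h' //.
  + case: asboolP => // hm; case: hm => y.
    by rewrite ltnS leq_eqVlt => /predU1P[->|/h].
  + by case: asboolP => // hm; case: h'; apply: hm.
  + by case: h => y lty; apply/h'/ltnW.
- apply: recseq_ext (recseq_natrec (recseq_num 0) (recseq_if (recseq_nth 1)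
    (recseq_skip IHb) (recseq_num 1)) (recseq_value t)) => e /=.
  elim: (value e t) => [|m /= ->]; first by rewrite asboolF // => -[].
  rewrite /= ?drop0; case: asboolP => h /=; case: asboolP => h' //.
  + by case: h' ; have [y lty hy] := h; exists y => //; apply: ltnW.
  + by case: asboolP => // hm; case: hm; exists m.
  + case: asboolP => // -[y].
    by rewrite ltnS leq_eqVlt => /predU1P[->//|lty hy]; case: h; exists y.
Qed.

(** Since b expresses non-membership, the decision function returns 0 where b holds. *)
Lemma decidable_by_bounded (L : set bform) b :
  (forall p, holds [:: goedel p] b <-> ~ L p) -> decidable_logic L.
Proof.
move=> bL; exists (fun v => if `[<holds (tval v) b>] : nat is 0 then 1 else 0).
split.
  exact: (@recseq_if _ _ _ (@recseq_holds b) (recseq_num 1) (recseq_num 0) 1).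
move=> p; split=> [Lp|/bL Lp]; last by rewrite asboolT.
by rewrite asboolF //; apply/bL.
Qed.

(** * Arithmetization *)

(* A left inverse of [goedel] that is a homomorphism on all numbers, so that
   every number, and not only every Goedel number, has a truth value. *)
Fixpoint form_rec (n q : nat) : bform :=
  if n is m.+1 then
    match CodeSeq.decode q with
    | [:: 0; i] => Var i
    | [:: 2; a; b] => Imp (form_rec m a) (form_rec m b)
    | [:: 3; c; a] => Dia (c == 1) (form_rec m a)
    | _ => Bot
    end
  else Bot.

Definition form_of (q : nat) : bform := form_rec q.+1 q.

(** The entries of a decoded sequence are smaller than its code, so any fuel above q suffices. *)
Lemma form_rec_stable m n q : q < m -> q < n -> form_rec m q = form_rec n q.
Proof.
elim: m n q => // m IHm [|n] q // ltm ltn /=.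
have le c : c \in CodeSeq.decode q -> form_rec m c = form_rec n c.
  move=> /(allP (CodeSeq.gtn_decode q)) cq.
  by apply: IHm; [apply: leq_trans cq ltm|apply: leq_trans cq ltn].
case: (CodeSeq.decode q) le => [|[|[|[|[|?]]]] [|a [|b [|? ?]]]] le //.
- by rewrite !le // !inE eqxx ?orbT.
- by rewrite !le // !inE eqxx ?orbT.
Qed.

Lemma mem_code_lt (c : nat) (s : seq nat) :
  c \in s -> c < CodeSeq.code s.
Proof. by move=> cs; apply: (allP (CodeSeq.ltn_code s)). Qed.

Lemma form_of_code s : form_of (CodeSeq.code s) =
  match s with
  | [:: 0; i] => Var i
  | [:: 2; a; b] => Imp (form_of a) (form_of b)
  | [:: 3; c; a] => Dia (c == 1) (form_of a)
  | _ => Bot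
  end.
Proof.
rewrite {1}/form_of; set m := CodeSeq.code s; rewrite /= CodeSeq.codeK.
have E c : c \in s -> form_rec m c = form_of c.
  by move=> cs; apply: form_rec_stable; rewrite // mem_code_lt.
case: s @m E => [|[|[|[|[|?]]]] [|a [|b [|? ?]]]] m E //.
- by rewrite !E // !inE eqxx ?orbT.
- by rewrite !E // !inE eqxx ?orbT.
Qed.

Lemma goedelK : cancel goedel form_of.
Proof.
elim=> [i||p IHp q IHq|a p IHp].
- exact: (form_of_code [:: 0; i]).
- exact: (form_of_code [:: 1]).
- by rewrite (form_of_code [:: 2; goedel p; goedel q]) IHp IHq.
- by rewrite (form_of_code [:: 3; nat_of_bool a; goedel p]) IHp; case: a.
Qed.

Lemma sumn_size_code s : sumn s + size s <= CodeSeq.code s.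
Proof.
elim: s => //= m s IHs; rewrite addnS -addnA.
apply: (@leq_trans (2 ^ m + CodeSeq.code s)).
  exact: (leq_add (ltn_expl m (ltnSn 1)) IHs).
rewrite mulnS leq_add2l -addnn; apply: leq_trans (leq_addr _ _) _.
by apply: leq_pmull; rewrite expn_gt0.
Qed.

(** This makes 2 ^ [goedel p], a value of the term language, a bound for the size of
    countermodels. *)
Lemma num_subforms_goedel p : num_subforms p <= goedel p.
Proof.
apply: leq_trans (size_undup _) _.
elim: p => [i||p IHp q IHq|a p IHp] //.
- apply: leq_trans (sumn_size_code [:: 2; goedel p; goedel q]).
  by rewrite /= size_cat addn0 addn3 add2n ltnS !leqW // leq_add.
- apply: leq_trans (sumn_size_code [:: 3; nat_of_bool a; goedel p]).
  by rewrite /= addn0 addn3 add3n ltnS (leq_trans IHp) // !leqW // leq_addl.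
Qed.

(* The formulas below are interpreted in environments extending
   [:: V; D; R; N; g], where the worlds are the numbers below N, bit x * N + y
   of R and of D is the corresponding relation between x and y, and bit
   q * N + x of V is the truth value at x of the formula with code q <= g. *)
Definition rel_bit (a : bool) (d x y : nat) : bounded :=
  Bit (Idx (if a then d.+1 else d.+2)) (Add (Mul (Idx x) (Idx d.+3)) (Idx y)).

(** Here and in [rel_bit], d counts the quantifiers crossed, so V, D, R and N have indices d, d+1,
    d+2 and d+3. *)
Definition val_bit (d : nat) (t : term) (x : nat) : bounded :=
  Bit (Idx d) (Add (Mul t (Idx d.+3)) (Idx x)).

(** Only pairs with x < y are constrained; the symmetry of D supplies the others. *)
Definition total_formula : bounded :=
  All (Idx 3) (All (Idx 4) (Impl (Less (Idx 1) (Idx 0)) (rel_bit true 2 1 0))).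

Definition sym_formula (a : bool) : bounded :=
  All (Idx 3) (All (Idx 4) (Impl (rel_bit a 2 1 0) (rel_bit a 2 0 1))).

Definition con_formula : bounded :=
  All (Exp2 (Idx 3))
    (Impl (Ex (Idx 4) (Bit (Idx 1) (Idx 0)))
    (Impl (Ex (Idx 4) (Impl (Bit (Idx 1) (Idx 0)) False_))
          (Ex (Idx 4) (Ex (Idx 5)
             (Conj (rel_bit false 3 1 0)
             (Conj (Bit (Idx 2) (Idx 1))
                   (Impl (Bit (Idx 2) (Idx 0)) False_))))))).

(** Colourings are replaced by relations giving each world at least one colour; this is equivalent,
    since a colouring can be chosen inside such a relation. *)
Definition chi_formula (k : nat) : bounded :=
  All (Exp2 (Mul (Idx 3) (Cst k)))
    (Impl (All (Idx 4) (Ex (Cst k)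
             (Bit (Idx 2) (Add (Mul (Idx 1) (Cst k)) (Idx 0)))))
          (Ex (Cst k) (Ex (Idx 5) (Ex (Idx 6)
             (Conj (rel_bit false 4 1 0)
             (Conj (Bit (Idx 3) (Add (Mul (Idx 1) (Cst k)) (Idx 2)))
                   (Bit (Idx 3) (Add (Mul (Idx 0) (Cst k)) (Idx 2))))))))).

(** In this and the next two definitions c is the code of the compound formula, and the guard
    restricts it to codes up to g, where V has rows. *)
Definition bot_formula : bounded :=
  let c := Code (Cst 1) (Cst 0) in
  All (Idx 3) (Impl (Less c (Succ (Idx 5))) (Impl (val_bit 1 c 0) False_)).

Definition imp_formula : bounded :=
  let c := Code (Cst 2) (Code (Idx 2) (Code (Idx 1) (Cst 0))) in
  let rhs := Impl (val_bit 3 (Idx 2) 0) (val_bit 3 (Idx 1) 0) in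
  All (Succ (Idx 4)) (All (Succ (Idx 5)) (All (Idx 5)
    (Impl (Less c (Succ (Idx 7)))
          (Conj (Impl (val_bit 3 c 0) rhs) (Impl rhs (val_bit 3 c 0)))))).

Definition dia_formula (a : bool) : bounded :=
  let c := Code (Cst 3) (Code (Cst a) (Code (Idx 1) (Cst 0))) in
  let rhs := Ex (Idx 5) (Conj (rel_bit a 3 1 0) (val_bit 3 (Idx 2) 0)) in
  All (Succ (Idx 4)) (All (Idx 4)
    (Impl (Less c (Succ (Idx 6)))
          (Conj (Impl (val_bit 2 c 0) rhs) (Impl rhs (val_bit 2 c 0))))).

Definition frame_formula (k : nat) : bounded :=
  Conj (Conj total_formula (Conj (sym_formula true) (sym_formula false)))
       (Conj con_formula (chi_formula k)).

Definition truth_formula : bounded :=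
  Conj (Conj bot_formula imp_formula)
       (Conj (dia_formula true) (dia_formula false)).

Definition countermodel_formula (k : nat) : bounded :=
  Ex (Succ (Exp2 (Idx 0)))
  (Ex (Exp2 (Mul (Idx 0) (Idx 0)))
  (Ex (Exp2 (Mul (Idx 1) (Idx 1)))
  (Ex (Exp2 (Mul (Succ (Idx 3)) (Idx 2)))
  (Conj (frame_formula k)
  (Conj truth_formula
        (Ex (Idx 3) (Impl (val_bit 1 (Idx 5) 0) False_))))))).

(** * Correctness of the coding along a numbering of the worlds *)

Section Coding.
Variables (X : Type) (R : bool -> X -> X -> Prop) (rank : X -> nat).
Variables (v d r N g : nat).
Hypothesis rank_lt : forall x, rank x < N.
Hypothesis rank_inj : injective rank.
Hypothesis rank_surj : forall i, i < N -> exists x, rank x = i.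
Hypothesis codedR : forall a x y,
  bit (if a then d else r) (rank x * N + rank y) <-> R a x y.
Local Notation env := [:: v; d; r; N; g].

Lemma all_rank (P : nat -> Prop) :
  (forall i, i < N -> P i) <-> forall x, P (rank x).
Proof. by split=> [h x|h i /rank_surj[x <-]]; [apply: h|]. Qed.

Lemma ex_rank (P : nat -> Prop) :
  (exists2 i, i < N & P i) <-> exists x, P (rank x).
Proof.
split=> [[i /rank_surj[x <-] Px]|[x Px]]; first by exists x.
by exists (rank x).
Qed.

Lemma coded_universal :
  holds env (Conj total_formula (Conj (sym_formula true) (sym_formula false)))
  <-> universal (Frame R).
Proof.
have symE a : holds env (sym_formula a) <-> (forall x y, R a x y -> R a y x).
  have -> : holds env (sym_formula a) = (forall x, x < N -> forall y, y < N ->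
    bit (if a then d else r) (x * N + y) ->
    bit (if a then d else r) (y * N + x)) by case: a.
  split=> [h x y /codedR xy|h].
    by apply/codedR; apply: h xy; apply: rank_lt.
  by apply/all_rank => x; apply/all_rank => y /codedR/h/codedR.
rewrite -[holds _ _]/(holds env total_formula /\ (holds env (sym_formula true)
  /\ holds env (sym_formula false))).
rewrite !symE.
(* [holds] computes, so conversion replaces de Bruijn indices by names; the later proofs do the
   same. *)
rewrite -[holds _ _]/(forall x, x < N -> forall y, y < N -> x < y ->
  bit d (x * N + y)).
split=> [[tot [symD symR]]|[tot symD symR]].
  split=> // x y.
  have [ltxy|ltyx|/rank_inj] := ltngtP (rank x) (rank y); last by left.
    by right; apply/(codedR true); apply: tot.
  by right; apply: symD; apply/(codedR true); apply: tot.
split=> //; apply/all_rank => x; apply/all_rank => y ltxy.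
apply/(codedR true); case: (tot x y) => // xy.
by rewrite xy ltnn in ltxy.
Qed.

Lemma coded_connected : holds env con_formula <-> connected (Frame R).
Proof.
rewrite -[holds _ _]/(forall c, c < 2 ^ N -> (exists2 x, x < N & bit c x) ->
  (exists2 x, x < N & ~ bit c x) ->
  exists2 x, x < N & exists2 y, y < N &
    bit r (x * N + y) /\ (bit c x /\ ~ bit c y)).
split=> [h S [y Sy] [z Sz]|conR c _ /ex_rank[y cy] /ex_rank[z cz]].
  have [c ltc cS] := exists_bits N (fun i => exists2 x, rank x = i & S x).
  have {}cS x : bit c (rank x) <-> S x.
    apply: iff_trans (cS _ (rank_lt x)) _.
    by split=> [[x' /rank_inj->]//|Sx]; exists x.
  have := h c ltc; rewrite !ex_rank => -[||u].
  - by exists y; apply/cS.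
  - by exists z; apply: contra_not Sz => /cS.
  move=> /ex_rank[w [/(codedR false) uw [/cS Su Sw]]].
  by exists u, w; split=> //; apply: contra_not Sw => /cS.
have [||y' [z' [yz yc zc]]] := conR [set x | bit c (rank x)].
- by exists y.
- by exists z.
apply/ex_rank; exists y'; apply/ex_rank; exists z'.
by split; first exact/(codedR false).
Qed.

Lemma coded_uncolorable k :
  holds env (chi_formula k) <-> uncolorable k (Frame R).
Proof.
rewrite -[holds _ _]/(forall c, c < 2 ^ (N * k) ->
  (forall x, x < N -> exists2 i, i < k & bit c (x * k + i)) ->
  exists2 i, i < k & exists2 x, x < N & exists2 y, y < N &
    bit r (x * N + y) /\ (bit c (x * k + i) /\ bit c (y * k + i))).
split=> [h c|uncR b _ /all_rank cov].
  have [b ltb bP] := exists_bits2 N k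
    (fun m i => exists2 x, rank x = m & c x = i :> nat).
  have {}bP x i : i < k -> bit b (rank x * k + i) <-> c x = i :> nat.
    move=> lti; apply: iff_trans (bP _ _ (rank_lt x) lti) _.
    by split=> [[x' /rank_inj->]//|cx]; exists x.
  have [|i lti] := h b ltb.
    by apply/all_rank => x; exists (c x) => //; apply/bP.
  move=> /ex_rank[x /ex_rank[y [/(codedR false) xy [/bP xi /bP yi]]]].
  by exists x, y; split=> //; apply: ord_inj; rewrite xi // yi.
(* A monochromatic edge for a colouring chosen inside the relation b is one for b. *)
have [c cP] := choice (fun x => let: ex_intro2 i lti ix := cov x in
  ex_intro (fun i : 'I_k => bit b (rank x * k + i)) (Ordinal lti) ix).
have [x [y [xy cxy]]] := uncR c; exists (c x) => //.
apply/ex_rank; exists x; apply/ex_rank; exists y.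
by split; [exact/(codedR false)|split; rewrite // cxy].
Qed.

Definition coded_val (i : nat) : set (Frame R) :=
  [set x | bit v (goedel (Var i) * N + rank x)].

(** Components have smaller codes than the formula, so the induction stays among codes up to g. *)
Lemma coded_sat : holds env truth_formula ->
  forall p, goedel p <= g -> forall x : Frame R,
  sat coded_val x p <-> bit v (goedel p * N + rank x).
Proof.
move=> [[hbot himp] [hdiaD hdiaR]].
elim=> [i||p IHp q IHq|a p IHp] leg x //.
- by split=> //; apply: (hbot (rank x) (rank_lt x)).
- have ltp : goedel p <= g.
    apply: leq_trans leg; apply/ltnW/mem_code_lt.
    by rewrite !inE eqxx !orbT.
  have ltq : goedel q <= g.
    apply: leq_trans leg; apply/ltnW/mem_code_lt.
    by rewrite !inE eqxx !orbT.
  rewrite sat_imp IHp // IHq //.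
  have [h1 h2] := himp (goedel p) ltp (goedel q) ltq (rank x) (rank_lt x) leg.
  by split.
- have ltp : goedel p <= g.
    apply: leq_trans leg; apply/ltnW/mem_code_lt.
    by rewrite !inE eqxx !orbT.
  pose rhs := exists2 y, y < N &
    bit (if a then d else r) (rank x * N + y) /\ bit v (goedel p * N + y).
  have [h1 h2] : (bit v (goedel (Dia a p) * N + rank x) -> rhs) /\
                 (rhs -> bit v (goedel (Dia a p) * N + rank x)).
    rewrite {}/rhs.
    case: a leg => leg.
      exact: (hdiaD (goedel p) ltp (rank x) (rank_lt x) leg).
    exact: (hdiaR (goedel p) ltp (rank x) (rank_lt x) leg).
  rewrite sat_dia; split=> [[y [xy yp]]|/h1/ex_rank[y [/codedR xy yp]]].
    by apply: h2; apply/ex_rank; exists y; split; [apply/codedR|apply/IHp].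
  by exists y; split=> //; apply/IHp.
Qed.

(** The clauses hold at every number up to g, Goedel number or not, because [form_of] commutes with
    the coded connectives. *)
Lemma coded_truth (V : nat -> set (Frame R)) :
  (forall q x, q <= g -> bit v (q * N + rank x) <-> sat V x (form_of q)) ->
  holds env truth_formula.
Proof.
move=> vP.
have diaP a : holds env (dia_formula a).
  have -> : holds env (dia_formula a) = (forall p, p < g.+1 -> forall x, x < N ->
    let c := CodeSeq.code [:: 3; nat_of_bool a; p] in c < g.+1 ->
    let rhs := exists2 y, y < N &
      bit (if a then d else r) (x * N + y) /\ bit v (p * N + y) in
    (bit v (c * N + x) -> rhs) /\ (rhs -> bit v (c * N + x))) by case: a.
  move=> p lep; apply/all_rank => x c lec rhs.
  suff : bit v (c * N + rank x) <-> rhs by [].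
  apply: (iff_trans (vP c x lec)); rewrite form_of_code.
  have -> : (nat_of_bool a == 1) = a by case: a {c lec rhs}.
  split=> [[y [/codedR xy /(vP _ _ lep) yp]]|]; first by apply/ex_rank; exists y.
  by move=> /ex_rank[y [/codedR xy /(vP _ _ lep) yp]]; exists y.
split; split=> //.
- rewrite -[holds _ _]/(forall x, x < N -> CodeSeq.code [:: 1] < g.+1 ->
    ~ bit v (CodeSeq.code [:: 1] * N + x)).
  by apply/all_rank => x le1 /(vP (CodeSeq.code [:: 1]) _ le1); rewrite form_of_code.
- rewrite -[holds _ _]/(forall p, p < g.+1 -> forall q, q < g.+1 ->
    forall x, x < N ->
    let c := CodeSeq.code [:: 2; p; q] in c < g.+1 ->
    let rhs := bit v (p * N + x) -> bit v (q * N + x) in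
    (bit v (c * N + x) -> rhs) /\ (rhs -> bit v (c * N + x))).
  move=> p lep q leq; apply/all_rank => x c lec rhs.
  suff : bit v (c * N + rank x) <-> rhs by [].
  apply: (iff_trans (vP c x lec)); rewrite form_of_code sat_imp.
  by split=> h /(vP _ _ lep)/h/(vP _ _ leq).
Qed.

End Coding.

(** * Decidability and the combined result *)

Lemma decidable_Chi_Con k : decidable_logic (log_plus KBneq [set Chi k; Con]).
Proof.
apply: (@decidable_by_bounded _ (countermodel_formula k)) => p.
set g := goedel p.
rewrite -[holds _ _]/(exists2 N, N < (2 ^ g).+1 &
  exists2 r, r < 2 ^ (N * N) & exists2 d, d < 2 ^ (N * N) &
  exists2 v, v < 2 ^ (g.+1 * N) &
  holds [:: v; d; r; N; g] (frame_formula k) /\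
  (holds [:: v; d; r; N; g] truth_formula /\
  (exists2 x, x < N & ~ bit v (g * N + x)))).
split=> [[N _ [r _ [d _ [v _ [hframe [htruth [x ltx xp]]]]]]] Lp|].
  (* A numerical solution is decoded as a frame on the numbers below N, each its own rank. *)
  pose R a (y z : 'I_N) : Prop := bit (if a then d else r) (y * N + z).
  have lt_N (y : 'I_N) : y < N by [].
  have surj i : i < N -> exists y : 'I_N, y = i :> nat.
    by move=> lti; exists (Ordinal lti).
  have codedR a (y z : 'I_N) :
    bit (if a then d else r) (y * N + z) <-> R a y z by [].
  have [huniv [hcon hchi]] := hframe.
  have univR := (coded_universal v g lt_N (@ord_inj N) surj codedR).1 huniv.
  have conR := (coded_connected v g lt_N (@ord_inj N) surj codedR).1 hcon.
  have chiR := (coded_uncolorable v g lt_N (@ord_inj N) surj codedR k).1 hchi.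
  apply: xp; apply/(coded_sat lt_N surj codedR htruth (leqnn _) (Ordinal ltx)).
  exact: (frame_of_Chi_Con univR conR chiR).
move=> /finite_countermodel[X [R [leX [univR conR chiR] [V [x xp]]]]].
pose N := #|X|; pose rank (y : X) : nat := enum_rank y.
have rank_lt y : rank y < N by apply: ltn_ord.
have rank_inj : injective rank by move=> y z /ord_inj/enum_rank_inj.
have surj i : i < N -> exists y, rank y = i.
  by move=> lti; exists (enum_val (Ordinal lti)); rewrite /rank enum_valK.
have coding a : exists2 c, c < 2 ^ (N * N) &
    forall y z, bit c (rank y * N + rank z) <-> R a y z.
  have [c ltc cP] := exists_bits2 N N (fun i j =>
    exists y z, [/\ rank y = i, rank z = j & R a y z]).
  exists c => // y z; apply: iff_trans (cP _ _ (rank_lt y) (rank_lt z)) _.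
  by split=> [[y' [z' [/rank_inj-> /rank_inj->]]]//|yz]; exists y, z.
have [[r ltr rP] [d ltd dP]] := (coding false, coding true).
(* There are g + 1 rows because the codes range from 0 to g inclusive. *)
have [v ltv vP] := exists_bits2 g.+1 N (fun q j =>
  exists2 y, rank y = j & sat (F := Frame R) V y (form_of q)).
have {}vP q y : q <= g ->
    bit v (q * N + rank y) <-> sat (F := Frame R) V y (form_of q).
  move=> leq; apply: iff_trans (vP q _ leq (rank_lt y)) _.
  by split=> [[z /rank_inj->]//|yq]; exists y.
have codedR a y z : bit (if a then d else r) (rank y * N + rank z) <-> R a y z.
  by case: a; [apply: dP|apply: rP].
exists N.
  rewrite ltnS (leq_trans leX) // leq_exp2l //; exact: num_subforms_goedel.
exists r => //; exists d => //; exists v => //; split.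
  split; first exact/(coded_universal v g rank_lt rank_inj surj codedR).
  split; first exact/(coded_connected v g rank_lt rank_inj surj codedR).
  exact/(coded_uncolorable v g rank_lt rank_inj surj codedR).
split; first exact: (coded_truth rank_lt surj codedR vP).
by exists (rank x) => // /(vP _ _ (leqnn g)); rewrite goedelK.
Qed.

Theorem theorem3 (k : nat) :
  (exponential_fmp (log_plus KBneq [set Con]) /\
   decidable_logic (log_plus KBneq [set Con])) /\
  (exponential_fmp (log_plus KBneq [set Chi k; Con]) /\
   decidable_logic (log_plus KBneq [set Chi k; Con])).
Proof.
suff main j : exponential_fmp (log_plus KBneq [set Chi j; Con]) /\
    decidable_logic (log_plus KBneq [set Chi j; Con]).
  by split; [rewrite log_plus_Chi0|]; apply: main.
split; last exact: decidable_Chi_Con.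
move=> p /finite_countermodel[X [R [leX [univR conR chiR] pF]]].
by exists X, R; split=> //; apply: frame_of_Chi_Con.
Qed.
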